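(* Let $\Sigma$ be a switched linear differential system with modes $\mathfrak{B}_k=\ker R_k(\frac{d}{dt})$, $k=1,\ldots,N$, where $R_k\in\mathbb{R}^{\tt w\times\tt w}[\xi]$ is nonsingular and $\mathfrak{B}_k$ is asymptotically stable. Let $n_k=\deg\det R_k$, let $X_k\in\mathbb{R}^{n_k\times\tt w}[\xi]$ be a minimal state map for $\mathfrak{B}_k$, write $R_k(\xi)=\sum_{i=0}^{L_k}R_{k,i}\xi^i$, $X_k(\xi)=\sum_{i=0}^{L_k-1}X_{k,i}\xi^i$, and set $\widetilde{R}_k:=[R_{k,0}\ \cdots\ R_{k,L_k}]$, $\widetilde{X}_k:=[X_{k,0}\ \cdots\ X_{k,L_k-1}]$. Denote the roots of $\det R_k(\xi)$ (counted with multiplicity) by $\lambda_{k,i}$, $i=1,\ldots,n_k$, assume that the algebraic multiplicity of each $\lambda_{k,i}$ equals $\dim\ker R_k(\lambda_{k,i})$, and let $w_{k,i}\in\mathbb{C}^{\tt w}$ satisfy $R_k(\lambda_{k,i})w_{k,i}=0$, with the $w_{k,i}$ associated with equal $\lambda_{k,i}$ linearly independent. Define $V_k:=[X_k(\lambda_{k,1})w_{k,1}\ \cdots\ X_k(\lambda_{k,n_k})w_{k,n_k}]\in\mathbb{C}^{n_k\times n_k}$, and let $L_{k\to\ell}$, $k\neq\ell$, be the re-initialisation maps of $\Sigma$. If there exist $\overline{K}_k\in\mathbb{R}^{n_k\times n_k}$, $\overline{Y}_k\in\mathbb{R}^{\tt w\times n_k}$, $k=1,\ldots,N$, such that $$\widetilde{\Phi}_k:=\begin{bmatrix}0_{\tt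 w\times n_k}\\ \widetilde{X}_k^\top\end{bmatrix}\overline{K}_k\begin{bmatrix}\widetilde{X}_k&0_{n_k\times\tt w}\end{bmatrix}+\begin{bmatrix}\widetilde{X}_k^\top\\0_{\tt w\times n_k}\end{bmatrix}\overline{K}_k\begin{bmatrix}0_{n_k\times\tt w}&\widetilde{X}_k\end{bmatrix}-\begin{bmatrix}\widetilde{X}_k^\top\\0_{\tt w\times n_k}\end{bmatrix}\overline{Y}_k^\top\widetilde{R}_k-\widetilde{R}_k^\top\overline{Y}_k\begin{bmatrix}\widetilde{X}_k&0_{n_k\times\tt w}\end{bmatrix}\leq0,$$ then there exist $\overline{F}_k\in\mathbb{R}^{n_k\times n_k}$ such that $\widetilde{\Phi}_k=\begin{bmatrix}\widetilde{X}_k^\top\\0_{\tt w\times n_k}\end{bmatrix}\overline{F}_k\begin{bmatrix}\widetilde{X}_k&0_{n_k\times\tt w}\end{bmatrix}$, $k=1,\ldots,N$. Moreover, if for all $k,\ell=1,\ldots,N$, $\ell\neq k$, $$\overline{F}_k<0\quad\text{and}\quad V_k^*\overline{K}_kV_k\geq V_k^*L_{k\to\ell}^\top\overline{K}_\ell L_{k\to\ell}V_k,$$ then $\Sigma$ is asymptotically stable and $\{X_k(\zeta)^\top\overline{K}_kX_k(\eta)\}_{k=1,\ldots,N}$ induces a multiple Lyapunov function for $\Sigma$.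
   Context: Behaviours: $\ker R(\frac{d}{dt})=\{w\in C^\infty(\mathbb{R},\mathbb{R}^{\tt w}):R(\frac{d}{dt})w=0\}$. A minimal state map for $\ker R(\frac{d}{dt})$ ($R$ nonsingular) is a matrix $X\in\mathbb{R}^{n\times\tt w}[\xi]$, $n=\deg\det R$, whose rows form a basis of the real vector space $\{f\in\mathbb{R}^{1\times\tt w}[\xi]: fR^{-1}\text{ strictly proper}\}$. For nonsingular $R$, $f\bmod R:=sR$ where $fR^{-1}=s+p$, $s$ strictly proper rational, $p$ polynomial (rowwise for matrices). SLDS: $\Sigma=\{\mathcal{P},\mathcal{F},\mathcal{S},\mathcal{G}\}$ with $\mathcal{P}=\{1,\ldots,N\}$, modes $\mathcal{F}=\{\mathfrak{B}_1,\ldots,\mathfrak{B}_N\}$ (autonomous), switching signals $\mathcal{S}$ = piecewise constant right-continuous $s:\mathbb{R}\to\mathcal{P}$ with finitely many switching instants $t_1<t_2<\cdots$ (points where $s$ jumps) in bounded intervals, and gluing conditions $(G^-_{k\to\ell},G^+_{k\to\ell})$, polynomial matrices with $\tt w$ columns, $k\neq\ell$. The switched behaviour $\mathfrak{B}^\Sigma$ consists of all $w$ such that for some $s\in\mathcal{S}$, on each $[t_i,t_{i+1})$ $w$ agrees with a trajectory of $\mathfrak{B}_{s(t_i)}$, and $G^+_{s(t_{i-1})\to s(t_i)}(\frac{d}{dt})w(t_i^+)=G^-_{s(t_{i-1})\to s(t_i)}(\frac{d}{dt})w(t_i^-)$ at each switching instant. $\Sigma$ is asymptotically stable if $w(t)\to0$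 as $t\to\infty$ for all $w\in\mathfrak{B}^\Sigma$. Re-initialisation maps: there are constant matrices $F^\pm_{k\to\ell}$ with $G^-_{k\to\ell}\bmod R_k=F^-_{k\to\ell}X_k$ and $G^+_{k\to\ell}\bmod R_\ell=F^+_{k\to\ell}X_\ell$. Standing assumption: the gluing conditions are well-posed, meaning $F^-_{k\to\ell}v_k=F^+_{k\to\ell}v_\ell$ has at most one solution $v_\ell$ for each $v_k$ (so $F^+_{k\to\ell}$ has full column rank); the re-initialisation map is $L_{k\to\ell}:=F^{+*}_{k\to\ell}F^-_{k\to\ell}$ for a fixed left inverse $F^{+*}_{k\to\ell}$ of $F^+_{k\to\ell}$. QDFs: $\Psi(\zeta,\eta)=\sum\Psi_{h,k}\zeta^h\eta^k$ induces $Q_\Psi(w)=\sum(\frac{d^hw}{dt^h})^\top\Psi_{h,k}\frac{d^kw}{dt^k}$. A multiple Lyapunov function for $\Sigma$ is a family of QDFs $Q_{\Psi_i}$, $i=1,\ldots,N$, with $Q_{\Psi_i}\ge0$ along $\mathfrak{B}_i$, $\frac{d}{dt}Q_{\Psi_i}<0$ along $\mathfrak{B}_i$ (i.e. $\le0$ and vanishing only for $w=0$), and $Q_{\Psi_{s(t_{j-1})}}(w)(t_j^-)\ge Q_{\Psi_{s(t_j)}}(w)(t_j^+)$ for every $w\in\mathfrak{B}^\Sigma$ and switching instant $t_j$. $V^*$ is the conjugate transpose. *)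

(* Defs.v *)
From HB Require Import structures.
From mathcomp Require Import all_boot all_order all_algebra.
From mathcomp Require Import all_classical all_reals all_analysis.
From mathcomp Require Import complex.
Import Order.TTheory GRing.Theory Num.Theory.
Import numFieldNormedType.Exports.
Set Implicit Arguments. Unset Strict Implicit. Unset Printing Implicit Defensive.
Local Open Scope ring_scope.
Local Open Scope classical_set_scope.

Section Defs.
Variable R : realType.
Variable w : nat.

Notation C := (R[i]).
Notation trajR := (R -> 'cV[R]_w).

Definition coefmx {m n} (P : 'M[{poly R}]_(m, n)) (i : nat) : 'M[R]_(m, n) :=
  map_mx (fun p : {poly R} => p`_i) P.

Definition mxsize {m n} (P : 'M[{poly R}]_(m, n)) : nat :=
  \max_(i < m) \max_(j < n) size (P i j).

Definition mxevalC {m n} (P : 'M[{poly R}]_(m, n)) (z : C) : 'M[C]_(m, n) :=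
  map_mx (fun p : {poly R} => (map_poly (fun x : R => (x%:C)%C) p).[z]) P.

(* strict properness of the rational row matrix  f R^{-1}  (R nonsingular):
   f R^{-1} = f adj(R) / det R, and a rational function p/q is strictly
   proper iff deg p < deg q, i.e. size p < size q. *)
Definition strictly_proper_rinv {m} (f : 'M[{poly R}]_(m, w))
    (Rm : 'M[{poly R}]_w) : Prop :=
  forall i j, (size ((f *m \adj Rm) i j) < size (\det Rm))%N.

(* M = G mod R, i.e. G R^{-1} = S + P with S strictly proper, P polynomial,
   and M = S R = G - P R. *)
Definition is_polymod {m} (Rm : 'M[{poly R}]_w) (G M : 'M[{poly R}]_(m, w)) : Prop :=
  exists P : 'M[{poly R}]_(m, w),
    M = G - P *m Rm /\ strictly_proper_rinv M Rm.

(* X is a minimal state map for ker R(d/dt): its n rows form a basis of the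
   real vector space { f in R^{1 x w}[xi] | f R^{-1} strictly proper }. *)
Definition minimal_state_map {n} (Rm : 'M[{poly R}]_w)
    (X : 'M[{poly R}]_(n, w)) : Prop :=
  [/\ strictly_proper_rinv X Rm,
      (forall c : 'rV[R]_n, map_mx polyC c *m X = 0 -> c = 0) &
      (forall f : 'rV[{poly R}]_w, strictly_proper_rinv f Rm ->
         exists c : 'rV[R]_n, f = map_mx polyC c *m X)].

(* the n x ((L+1) w) matrix [blk 0  blk 1 ... blk L] *)
Definition blockrow {n} (L : nat) (blk : 'I_L.+1 -> 'M[R]_(n, w))
  : 'M[R]_(n, L.+1 * w) :=
  \matrix_(r < n) mxvec (\matrix_(p < L.+1, q < w) blk p r q).

Definition Rtilde (L : nat) (Rm : 'M[{poly R}]_w) : 'M[R]_(w, L.+1 * w) :=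
  blockrow (fun p : 'I_L.+1 => coefmx Rm p).

Definition XtildeL {n} (L : nat) (X : 'M[{poly R}]_(n, w)) : 'M[R]_(n, L.+1 * w) :=
  blockrow (fun p : 'I_L.+1 => if (p < L)%N then coefmx X p else 0).

Definition XtildeR {n} (L : nat) (X : 'M[{poly R}]_(n, w)) : 'M[R]_(n, L.+1 * w) :=
  blockrow (fun p : 'I_L.+1 => if (0 < p)%N then coefmx X p.-1 else 0).

Definition Phitilde {n} (L : nat) (Rm : 'M[{poly R}]_w) (X : 'M[{poly R}]_(n, w))
    (K : 'M[R]_n) (Y : 'M[R]_(w, n)) : 'M[R]_(L.+1 * w) :=
  (XtildeR L X)^T *m K *m XtildeL L X
  + (XtildeL L X)^T *m K *m XtildeR L X
  - (XtildeL L X)^T *m Y^T *m Rtilde L Rm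
  - (Rtilde L Rm)^T *m Y *m XtildeL L X.

Definition real_nsd {n} (A : 'M[R]_n) : Prop :=
  A^T = A /\ forall x : 'cV[R]_n, (x^T *m A *m x) 0 0 <= 0.

Definition real_nd {n} (A : 'M[R]_n) : Prop :=
  A^T = A /\ forall x : 'cV[R]_n, x != 0 -> (x^T *m A *m x) 0 0 < 0.

Definition ctrmx {m n} (A : 'M[C]_(m, n)) : 'M[C]_(n, m) := (map_mx conjc A)^T.

Definition herm_psd {n} (A : 'M[C]_n) : Prop :=
  ctrmx A = A /\ forall x : 'cV[C]_n, 0 <= (ctrmx x *m A *m x) 0 0.

Definition realC {m n} (A : 'M[R]_(m, n)) : 'M[C]_(m, n) := map_mx (fun x => (x%:C)%C) A.

Definition Vmat {n} (X : 'M[{poly R}]_(n, w)) (lam : 'I_n -> C)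
    (wv : 'I_n -> 'cV[C]_w) : 'M[C]_n :=
  \matrix_(r < n, i < n) (mxevalC X (lam i) *m wv i) r 0.

Definition smooth (f : trajR) : Prop :=
  forall (k : nat) (t : R), derivable (derive1n k f) t 1.

Definition diffop {m} (P : 'M[{poly R}]_(m, w)) (f : trajR) (t : R) : 'cV[R]_m :=
  \sum_(i < mxsize P) coefmx P i *m derive1n i f t.

Definition behaviour (Rm : 'M[{poly R}]_w) : set trajR :=
  [set f | smooth f /\ forall t, diffop Rm f t = 0].

Definition converges_to_0 (f : trajR) : Prop := f t @[t --> +oo] --> (0 : 'cV[R]_w).

Definition behaviour_asympt_stable (Rm : 'M[{poly R}]_w) : Prop :=
  forall f, behaviour Rm f -> converges_to_0 f.

Variable N : nat.

(* t is a switching instant of s: s jumps at t, i.e. the (left) constant value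
   of s just before t differs from s t *)
Definition switch_instant (s : R -> 'I_N) (t : R) : Prop :=
  exists e : R, 0 < e /\ forall u, t - e < u < t -> s u != s t.

Definition switching_signal (s : R -> 'I_N) : Prop :=
  [/\ (forall t, exists2 e : R, 0 < e & forall u, t <= u < t + e -> s u = s t),
      (forall t, exists2 e : R, 0 < e & exists j, forall u, t - e < u < t -> s u = j) &
      (forall a b : R, finite_set [set t | a <= t <= b /\ switch_instant s t])].

(* u lies in the same interval [t_i, t_{i+1}) of constancy as t *)
Definition same_piece (s : R -> 'I_N) (t u : R) : Prop :=
  forall x, Num.min t u < x <= Num.max t u -> ~ switch_instant s x.

(* w is a trajectory of the SLDS with switching signal s; traj t is a
   trajectory of the active mode agreeing with w on the piece containing t *)
Definition switched_solution (Rm : 'I_N -> 'M[{poly R}]_w)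
    (g : 'I_N -> 'I_N -> nat)
    (Gm Gp : forall k l : 'I_N, 'M[{poly R}]_(g k l, w))
    (s : R -> 'I_N) (traj : R -> trajR) (f : trajR) : Prop :=
  [/\ switching_signal s,
      (forall t, behaviour (Rm (s t)) (traj t)),
      (forall t u, same_piece s t u -> f u = traj t u) &
      (* gluing: G^+_{k->l}(d/dt) f(t^+) = G^-_{k->l}(d/dt) f(t^-) with
         k = s(t^-), l = s(t); traj u (u < t in the previous piece) is the
         trajectory of mode k that f follows just before t *)
      (forall t u, switch_instant s t -> u < t ->
         (forall x, u < x < t -> ~ switch_instant s x) ->
         diffop (Gp (s u) (s t)) (traj t) t = diffop (Gm (s u) (s t)) (traj u) t)].

Definition switched_behaviour (Rm : 'I_N -> 'M[{poly R}]_w)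
    (g : 'I_N -> 'I_N -> nat)
    (Gm Gp : forall k l : 'I_N, 'M[{poly R}]_(g k l, w)) : set trajR :=
  fun f => exists s traj, switched_solution Rm Gm Gp s traj f.

Definition slds_asympt_stable (Rm : 'I_N -> 'M[{poly R}]_w)
    (g : 'I_N -> 'I_N -> nat)
    (Gm Gp : forall k l : 'I_N, 'M[{poly R}]_(g k l, w)) : Prop :=
  forall f, switched_behaviour Rm Gm Gp f -> converges_to_0 f.

(* Q_Psi(f)(t) = sum_{h,j} (f^(h))^T Psi_{h,j} f^(j), Psi(z,e) = sum Psi_{h,j} z^h e^j *)
Definition qdf (d : nat) (Psi : nat -> nat -> 'M[R]_w) (f : trajR) (t : R) : R :=
  \sum_(h < d) \sum_(j < d) ((derive1n h f t)^T *m Psi h j *m derive1n j f t) 0 0.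

(* coefficients of Psi(zeta,eta) = X(zeta)^T K X(eta) *)
Definition XKX_coef {n} (X : 'M[{poly R}]_(n, w)) (K : 'M[R]_n) (h j : nat) : 'M[R]_w :=
  (coefmx X h)^T *m K *m coefmx X j.

Definition qdf_XKX {n} (X : 'M[{poly R}]_(n, w)) (K : 'M[R]_n) : trajR -> R -> R :=
  qdf (mxsize X) (XKX_coef X K).

Definition multiple_lyapunov (Rm : 'I_N -> 'M[{poly R}]_w)
    (g : 'I_N -> 'I_N -> nat)
    (Gm Gp : forall k l : 'I_N, 'M[{poly R}]_(g k l, w)) (Q : 'I_N -> trajR -> R -> R) : Prop :=
  [/\ (forall i f, behaviour (Rm i) f -> forall t, 0 <= Q i f t),
      (forall i f, behaviour (Rm i) f ->
         (forall t, derive1 (Q i f) t <= 0) /\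
         ((forall t, derive1 (Q i f) t = 0) -> f = (fun _ => 0))) &
      (forall s traj f, switched_solution Rm Gm Gp s traj f ->
         forall t u, switch_instant s t -> u < t ->
         (forall x, u < x < t -> ~ switch_instant s x) ->
         Q (s t) (traj t) t <= Q (s u) (traj u) t)].

End Defs.

(* Main.v *)
Require Import Defs.
From HB Require Import structures.
From mathcomp Require Import all_boot all_order all_algebra.
From mathcomp Require Import all_classical all_reals all_analysis.
From mathcomp Require Import complex.
From mathcomp Require Import ring lra.
Import Order.TTheory GRing.Theory Num.Theory.
Import numFieldNormedType.Exports.
Local Open Scope ring_scope.

(** Since [Phi~] is negative semidefinite and its form vanishes on
    [ker [X~ 0]], that kernel lies in [ker Phi~]; this gives the factorisation
    through [F].

    Every polynomial row is a constant combination of the rows of [X_k] modulo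
    [R_k].  Hence along a trajectory [f] of mode [k] the state
    [x = X_k(d/dt) f] satisfies [x' = A x] and [f = C x], and evaluating
    [Phi~] on the jet of [f] shows that [Q = x^T K x] has derivative
    [x^T F x].  The form [- F] dominates every quadratic form, so [Q] decays
    exponentially; moreover [Q - c |f|^2] is nonincreasing for small [c > 0]
    and tends to [0], so [Q >= c |f|^2].

    The columns of [V_k] are eigenvectors of [A], independent because [C] maps
    them to the [w_{k,i}]; thus [V_k] is invertible, and the condition on
    [V_k^* K_k V_k] says precisely that [Q] does not increase at a switch, where
    the state is multiplied by [L_{k->l}].  So [exp (al t) Q] is nonincreasing
    across switches for a common rate [al > 0], and [f] tends to [0]. *)

(** * Algebra of bilinear forms *)

Definition bilin {F : pzRingType} {m n : nat} (A : 'M[F]_(m, n))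
    (x : 'cV[F]_m) (y : 'cV[F]_n) : F := (x^T *m A *m y) 0 0.

Section BilinearForms.
Variable F : comNzRingType.

Lemma bilin_tr m n (A : 'M[F]_(m, n)) x y : bilin A x y = bilin A^T y x.
Proof.
rewrite /bilin -[RHS](mxE trmx_key (fun i j => (y^T *m A^T *m x) j i)) -/(trmx _).
by rewrite !trmx_mul !trmxK mulmxA.
Qed.

Lemma bilinDl m n (A : 'M[F]_(m, n)) x x' y :
  bilin A (x + x') y = bilin A x y + bilin A x' y.
Proof. by rewrite /bilin (raddfD trmx) !mulmxDl mxE. Qed.

Lemma bilinZl m n (A : 'M[F]_(m, n)) a x y :
  bilin A (a *: x) y = a * bilin A x y.
Proof. by rewrite /bilin [(a *: x)^T]linearZ /= -!scalemxAl mxE. Qed.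

Lemma bilinDr m n (A : 'M[F]_(m, n)) x y y' :
  bilin A x (y + y') = bilin A x y + bilin A x y'.
Proof. by rewrite /bilin mulmxDr mxE. Qed.

Lemma bilinZr m n (A : 'M[F]_(m, n)) a x y :
  bilin A x (a *: y) = a * bilin A x y.
Proof. by rewrite /bilin -scalemxAr mxE. Qed.

Lemma bilinDm m n (A B : 'M[F]_(m, n)) x y :
  bilin (A + B) x y = bilin A x y + bilin B x y.
Proof. by rewrite /bilin mulmxDr mulmxDl mxE. Qed.

Lemma bilinNm m n (A : 'M[F]_(m, n)) x y : bilin (- A) x y = - bilin A x y.
Proof. by rewrite /bilin mulmxN mulNmx mxE. Qed.

Lemma bilin_congr m n p q (P : 'M[F]_(p, m)) (A : 'M[F]_(p, q))
    (Q : 'M[F]_(q, n)) x y :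
  bilin (P^T *m A *m Q) x y = bilin A (P *m x) (Q *m y).
Proof. by rewrite /bilin trmx_mul !mulmxA. Qed.

Lemma bilin0l m n (A : 'M[F]_(m, n)) y : bilin A 0 y = 0.
Proof. by rewrite /bilin trmx0 !mul0mx mxE. Qed.

Lemma bilin0r m n (A : 'M[F]_(m, n)) x : bilin A x 0 = 0.
Proof. by rewrite /bilin mulmx0 mxE. Qed.

Lemma bilin_mull m n p (P : 'M[F]_(p, m)) (A : 'M[F]_(p, n)) x y :
  bilin (P^T *m A) x y = bilin A (P *m x) y.
Proof. by rewrite /bilin trmx_mul !mulmxA. Qed.

Lemma bilin_mulr m n p (A : 'M[F]_(m, p)) (Q : 'M[F]_(p, n)) x y :
  bilin (A *m Q) x y = bilin A x (Q *m y).
Proof. by rewrite /bilin !mulmxA. Qed.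

Lemma bilinE m n (A : 'M[F]_(m, n)) x y :
  bilin A x y = \sum_i \sum_j A i j * (x i 0 * y j 0).
Proof.
rewrite /bilin mxE exchange_big /=; apply: eq_bigr => j _.
rewrite mxE mulr_suml; apply: eq_bigr => i _.
by rewrite mxE; ring.
Qed.

Lemma bilin_expand n (A : 'M[F]_n) x y t : A^T = A ->
  bilin A (x + t *: y) (x + t *: y)
  = bilin A x x + t * bilin A y x *+ 2 + t ^+ 2 * bilin A y y.
Proof.
move=> sA; rewrite bilinDl !bilinDr !bilinZl !bilinZr [bilin A x y]bilin_tr sA.
ring.
Qed.

End BilinearForms.

(** * Semidefinite and definite real forms: kernels, domination, factorisation *)

Section QuadraticForms.
Variable R : realType.

(** Moving from [x] in the direction [A x] changes the form by [2 t |A x|^2] to first order; if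
    [A x] were nonzero, a small [t > 0] would make the form positive. *)
Lemma real_nsd_ker n (A : 'M[R]_n) (x : 'cV[R]_n) :
  real_nsd A -> bilin A x x = 0 -> A *m x = 0.
Proof.
case=> sA nA Ax0.
have sE : bilin A (A *m x) x = \sum_i (A *m x) i 0 ^+ 2.
  rewrite /bilin -mulmxA mxE; apply: eq_bigr => i _.
  by rewrite [in LHS]mxE expr2.
have sge0 : 0 <= bilin A (A *m x) x by rewrite sE sumr_ge0 // => i _; exact: sqr_ge0.
have s0 : bilin A (A *m x) x = 0.
  set s := bilin A _ _ in sge0 *; pose q := bilin A (A *m x) (A *m x).
  have qle0 : q <= 0 := nA _.
  apply/eqP; rewrite eq_le sge0 andbT leNgt; apply/negP => sgt0.
  (* As [q <= 0], this step is positive and short enough for the linear term to beat [t^2 q]: the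
     form becomes [s^2 (2 - q) / (1 - q)^2 > 0]. *)
  pose t := s / (1 - q).
  have := nA (x + t *: (A *m x)).
  rewrite -/(bilin _ _ _) bilin_expand // Ax0 -/s -/q add0r.
  have d0 : 0 < 1 - q by lra.
  have -> : t * s *+ 2 + t ^+ 2 * q = s ^+ 2 * ((2 - q) / (1 - q) ^+ 2).
    by rewrite /t; field; rewrite lt0r_neq0.
  rewrite leNgt => /negP; apply.
  by rewrite mulr_gt0 ?exprn_gt0 // divr_gt0 ?exprn_gt0 //; lra.
apply/colP => i; rewrite [RHS]mxE; apply/eqP; rewrite -sqrf_eq0; apply/eqP.
by move: s0; rewrite sE => /psumr_eq0P => -> // j _; exact: sqr_ge0.
Qed.

Lemma real_nd_le0 n (A : 'M[R]_n) (x : 'cV[R]_n) : real_nd A -> bilin A x x <= 0.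
Proof.
case=> _ nA; have [->|xNz] := eqVneq x 0; first by rewrite bilin0l.
exact/ltW/nA.
Qed.

Lemma real_nd_unit n (A : 'M[R]_n) : real_nd A -> A \in unitmx.
Proof.
case=> sA nA; rewrite -row_free_unit -kermx_eq0.
apply/eqP/row_matrixP => i; rewrite row0; apply/eqP/negPn/negP => ki.
have kA : row i (kermx A) *m A = 0 by rewrite -row_mul mulmx_ker row0.
have := nA (row i (kermx A))^T.
rewrite trmxK kA mul0mx mxE ltxx => H; suff: false by [].
by apply: H; rewrite -trmx0 (inj_eq trmx_inj).
Qed.

(* Cauchy-Schwarz for the form [- A] against [A^-1 e_i], whose pairing with
   [x] reads off the coordinate [x i]. *)
Lemma real_nd_coord n (A : 'M[R]_n) : real_nd A ->
  forall i, exists2 c : R, 0 <= c &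
    forall x : 'cV[R]_n, x i 0 ^+ 2 <= c * - bilin A x x.
Proof.
move=> nA i; have uA := @real_nd_unit _ _ nA; have [sA ltA] := nA.
pose u := invmx A *m delta_mx i 0 : 'cV[R]_n.
have Au : A *m u = delta_mx i 0 by rewrite mulmxA mulmxV // mul1mx.
have uNz : u != 0.
  apply/eqP => u0; move: Au; rewrite u0 mulmx0 => /matrixP/(_ i 0).
  by rewrite !mxE !eqxx /= => /esym/eqP; rewrite oner_eq0.
have q0 : bilin A u u < 0 := ltA _ uNz.
exists (- bilin A u u); first by rewrite oppr_ge0 ltW.
move=> x.
have ux : bilin A u x = x i 0.
  rewrite bilin_tr sA /bilin -mulmxA Au mxE (bigD1 i) //= big1 ?addr0.
    by rewrite !mxE !eqxx mulr1.
  by move=> j ji; rewrite !mxE (negbTE ji) mulr0.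
(* This multiple of [u] maximises the form on the line through [x] in direction [u]; the maximum is
   [r - x_i^2 / q], so its sign is the Cauchy-Schwarz inequality. *)
have le0 : bilin A (x + (- x i 0 / bilin A u u) *: u)
                   (x + (- x i 0 / bilin A u u) *: u) <= 0.
  exact: real_nd_le0.
move: le0; rewrite bilin_expand // ux.
set q := bilin A u u in q0 *; set r := bilin A x x.
have -> : r + - x i 0 / q * x i 0 *+ 2 + (- x i 0 / q) ^+ 2 * q
        = r - x i 0 ^+ 2 / q by field; rewrite lt_eqF.
by rewrite subr_le0 -ler_ndivlMr ?invr_lt0 // invrK; lra.
Qed.

(** In coordinates, [|x_i x_j| <= x_i^2 + x_j^2], and each square is already bounded by a multiple
    of [- A]. *)
Lemma real_nd_dominates n (A B : 'M[R]_n) : real_nd A ->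
  exists2 c : R, 0 <= c & forall x, `|bilin B x x| <= c * - bilin A x x.
Proof.
move=> nA.
have [c c0 Hc] : exists2 c : 'I_n -> R, forall i, 0 <= c i &
    forall i (x : 'cV[R]_n), x i 0 ^+ 2 <= c i * - bilin A x x.
  have /choice[c Hc] : forall i, exists c : R, 0 <= c /\
      forall x : 'cV[R]_n, x i 0 ^+ 2 <= c * - bilin A x x.
    by move=> i; have [c c0 Hc] := @real_nd_coord _ _ nA i; exists c.
  by exists c => i; have [] := Hc i.
exists (\sum_i \sum_j `|B i j| * (c i + c j)).
  by do 2!(apply: sumr_ge0 => ? _); rewrite mulr_ge0 ?addr_ge0.
move=> x; rewrite bilinE mulr_suml.
apply: le_trans (ler_norm_sum _ _ _) _; apply: ler_sum => i _.
rewrite mulr_suml.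
apply: le_trans (ler_norm_sum _ _ _) _; apply: ler_sum => j _.
rewrite normrM -mulrA ler_wpM2l // mulrDl.
apply: le_trans (lerD (Hc i x) (Hc j x)).
rewrite ler_norml; apply/andP; split.
  have := sqr_ge0 (x i 0 + x j 0); have := sqr_ge0 (x i 0); have := sqr_ge0 (x j 0).
  nra.
have := sqr_ge0 (x i 0 - x j 0); have := sqr_ge0 (x i 0); have := sqr_ge0 (x j 0).
nra.
Qed.

Lemma real_nsd_factor m n (A : 'M[R]_n) (B : 'M[R]_(m, n)) :
  real_nsd A ->
  (forall x, B *m x = 0 -> bilin A x x = 0) ->
  A = B^T *m ((pinvmx B)^T *m A *m pinvmx B) *m B.
Proof.
move=> nA kA.
(* The columns of [cokermx B] span [ker B]. The form vanishes there, hence so does [A], which gives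
   the inclusion of row spaces. The other factor [B^T] then comes from the symmetry of [A]. *)
have sAB : (A <= B)%MS.
  rewrite submxE; apply/eqP/trmx_inj/row_matrixP => i.
  rewrite -tr_col colE -mulmxA (@real_nsd_ker _ A) ?trmx0 ?row0 //.
  by apply: kA; rewrite mulmxA mulmx_coker mul0mx.
have [sA _] := nA.
have := mulmxKpV sAB; move: (pinvmx B) => P e1.
rewrite !mulmxA -trmx_mul.
have -> : (P *m B)^T *m A = A.
  by rewrite -{1}sA -trmx_mul mulmxA e1.
by rewrite e1.
Qed.

End QuadraticForms.

(** * Polynomial matrices modulo [Rm] and their action on sequences of vectors *)

Section PolynomialAction.
Variables (R : realType) (w : nat).

Lemma polymod_exists m (Rm : 'M[{poly R}]_w) (H : 'M[{poly R}]_(m, w)) :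
  \det Rm != 0 -> exists P, strictly_proper_rinv (H - P *m Rm) Rm.
Proof.
(* Since [Rm *m \adj Rm] is the scalar [\det Rm], the entries of [(H - P Rm) adj Rm] are the
   remainders of those of [H adj Rm] modulo [\det Rm]. *)
move=> dR; exists (map_mx (fun p => p %/ \det Rm) (H *m \adj Rm)) => i j.
rewrite mulmxBl -mulmxA mul_mx_adj mul_mx_scalar.
have -> : forall A B : 'M[{poly R}]_(m, w), (A - B) i j = A i j - B i j.
  by move=> A B; rewrite !mxE.
set p := (H *m _) i j; rewrite [X in _ - X]mxE [X in _ * X]mxE -/p.
by rewrite mulrC {1}(divp_eq p (\det Rm)) addrAC subrr add0r ltn_modp.
Qed.

(** Used with [H = 'X *: X] it yields the state matrix, and with [H = 1] the matrix that recovers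
    the signal from its state. *)
Lemma state_map_rep n m (Rm : 'M[{poly R}]_w) (X : 'M[{poly R}]_(n, w))
    (H : 'M[{poly R}]_(m, w)) :
  \det Rm != 0 -> minimal_state_map Rm X ->
  exists (C : 'M[R]_(m, n)) (P : 'M[{poly R}]_(m, w)),
    H = map_mx polyC C *m X + P *m Rm.
Proof.
move=> dR [_ _ genX]; have [P HP] := @polymod_exists _ Rm H dR.
have /choice[c Hc] : forall i : 'I_m, exists c : 'rV[R]_n,
    row i (H - P *m Rm) = map_mx polyC c *m X.
  move=> i; apply: genX => i' j; rewrite -row_mul mxE; exact: HP.
exists (\matrix_i c i), P; apply/eqP; rewrite -subr_eq; apply/eqP.
apply/row_matrixP => i; rewrite Hc row_mul; congr (_ *m X).
by apply/rowP => j; rewrite !mxE.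
Qed.

(** The operator [P(d/dt)] with an arbitrary sequence [D] in place of the successive derivatives, so
    that its algebra needs no analysis; multiplication by ['X] becomes a shift of [D]. *)
Definition mxact {m} (P : 'M[{poly R}]_(m, w)) (D : nat -> 'cV[R]_w) : 'cV[R]_m :=
  \sum_(i < mxsize P) coefmx P i *m D i.

Lemma coefmx_mxsize m (P : 'M[{poly R}]_(m, w)) i :
  (mxsize P <= i)%N -> coefmx P i = 0.
Proof.
move=> Pi; apply/matrixP => a b; rewrite !mxE nth_default //.
apply: leq_trans Pi; rewrite /mxsize.
apply: leq_trans (leq_bigmax a); exact: (leq_bigmax b).
Qed.

Lemma sum_coefmx_widen m (P : 'M[{poly R}]_(m, w)) (D : nat -> 'cV[R]_w) a b :
  (forall i, (a <= i)%N -> coefmx P i = 0) -> (a <= b)%N ->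
  \sum_(i < a) coefmx P i *m D i = \sum_(i < b) coefmx P i *m D i.
Proof.
move=> Pa ab; rewrite (big_ord_widen _ (fun i => coefmx P i *m D i) ab).
rewrite big_mkcond; apply: eq_bigr => i _; case: ltnP => // ai.
by rewrite Pa // mul0mx.
Qed.

Lemma mxact_trunc m (P : 'M[{poly R}]_(m, w)) D M :
  (forall i, (M <= i)%N -> coefmx P i = 0) ->
  mxact P D = \sum_(i < M) coefmx P i *m D i.
Proof.
move=> PM; have [le|/ltnW le] := leqP (mxsize P) M.
  by apply: sum_coefmx_widen le => i; exact: coefmx_mxsize.
by rewrite (@sum_coefmx_widen _ _ _ _ _ PM le).
Qed.

Lemma coefmxD m (P Q : 'M[{poly R}]_(m, w)) i :
  coefmx (P + Q) i = coefmx P i + coefmx Q i.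
Proof. by apply/matrixP => a b; rewrite !mxE coefD. Qed.

Lemma mxactD m (P Q : 'M[{poly R}]_(m, w)) D :
  mxact (P + Q) D = mxact P D + mxact Q D.
Proof.
pose M := maxn (mxsize P) (mxsize Q).
have zP i : (M <= i)%N -> coefmx P i = 0.
  by rewrite geq_max => /andP[? _]; rewrite coefmx_mxsize.
have zQ i : (M <= i)%N -> coefmx Q i = 0.
  by rewrite geq_max => /andP[_ ?]; rewrite coefmx_mxsize.
rewrite !(@mxact_trunc _ _ _ M) // => [|i Mi]; last first.
  by rewrite coefmxD zP // zQ // addr0.
by rewrite -big_split; apply: eq_bigr => i _; rewrite coefmxD mulmxDl.
Qed.

Lemma coefmx_const_mul m n (C : 'M[R]_(m, n)) (P : 'M[{poly R}]_(n, w)) i :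
  coefmx (map_mx polyC C *m P) i = C *m coefmx P i.
Proof.
apply/matrixP => a b; rewrite !mxE coef_sum; apply: eq_bigr => c _.
by rewrite !mxE coefCM.
Qed.

Lemma mxact_const_mul m n (C : 'M[R]_(m, n)) (P : 'M[{poly R}]_(n, w)) D :
  mxact (map_mx polyC C *m P) D = C *m mxact P D.
Proof.
rewrite (@mxact_trunc _ _ _ (mxsize P)) => [|i Pi].
  rewrite mulmx_sumr; apply: eq_bigr => i _.
  by rewrite coefmx_const_mul mulmxA.
by rewrite coefmx_const_mul coefmx_mxsize // mulmx0.
Qed.

Lemma mxact_mulX m (P : 'M[{poly R}]_(m, w)) D :
  mxact ('X *: P) D = mxact P (fun i => D i.+1).
Proof.
have e0 : coefmx ('X *: P) 0 = 0.
  by apply/matrixP => a b; rewrite !mxE coefXM.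
have eS i : coefmx ('X *: P) i.+1 = coefmx P i.
  by apply/matrixP => a b; rewrite !mxE coefXM.
rewrite (@mxact_trunc _ _ _ (mxsize P).+1) => [|[//|i] Pi].
  rewrite big_ord_recl e0 mul0mx add0r; apply: eq_bigr => i _.
  by rewrite eS.
by rewrite eS coefmx_mxsize.
Qed.

(* Induction on a common degree bound of the entries of [P], peeling off the
   constant coefficient as [P = 'X *: P' + C]. *)
Lemma mxact_mul_eq0 m n (P : 'M[{poly R}]_(m, n)) (Q : 'M[{poly R}]_(n, w)) D :
  (forall j, mxact Q (fun i => D (i + j)%N) = 0) -> mxact (P *m Q) D = 0.
Proof.
have [d Pd] : exists d, forall a b, (size (P a b) <= d)%N.
  exists (\max_a \max_b size (P a b)) => a b.
  apply: leq_trans (leq_bigmax a); exact: (leq_bigmax b).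
elim: d P D Pd => [|d IH] P D Pd QD.
  have -> : P = 0.
    by apply/matrixP => a b; rewrite mxE; apply/eqP; rewrite -size_poly_eq0 -leqn0.
  rewrite mul0mx (@mxact_trunc _ _ _ 0) ?big_ord0 // => i _.
  by apply/matrixP => a b; rewrite !mxE coef0.
have eP : P = 'X *: map_mx (fun p => p %/ 'X) P + map_mx polyC (map_mx (horner_eval 0) P).
  apply/matrixP => a b; rewrite !mxE {1}(divp_eq (P a b) 'X) mulrC; congr (_ + _).
  by rewrite -['X]subr0 -polyC0 modp_XsubC.
rewrite eP mulmxDl mxactD mxact_const_mul -scalemxAl mxact_mulX.
have -> : mxact Q D = 0.
  by rewrite -[RHS](QD 0%N); congr mxact; apply/funext => i; rewrite addn0.
rewrite mulmx0 addr0 IH // => [a b|j].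
  by rewrite mxE size_divp ?polyX_eq0 // size_polyX leq_subLR add1n.
rewrite -[RHS](QD j.+1); congr mxact; apply/funext => i; by rewrite addnS.
Qed.

(** The column on the left stacks [D 0, ..., D L]. For a jet, this turns the coefficient matrices of
    [Phitilde] into differential operators. *)
Lemma blockrow_mul n L (blk : 'I_L.+1 -> 'M[R]_(n, w)) (D : nat -> 'cV[R]_w) :
  blockrow blk *m (mxvec (\matrix_(p < L.+1, q < w) D p q 0))^T
  = \sum_(p < L.+1) blk p *m D p.
Proof.
apply/colP => r; rewrite summxE mxE (reindex _ (curry_mxvec_bij _ _)) /=.
under [RHS]eq_bigr do rewrite mxE.
rewrite pair_bigA /=; apply: eq_bigr => -[p q] _ /=.
by rewrite [blockrow _ _ _]mxE [_^T _ _]mxE !mxvecE !mxE.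
Qed.

Section Tilde.
Variables (n L : nat) (Rm : 'M[{poly R}]_w) (X : 'M[{poly R}]_(n, w)).
Hypothesis degR : forall i, (L < i)%N -> coefmx Rm i = 0.
Hypothesis degX : forall i, (L <= i)%N -> coefmx X i = 0.

Lemma Rtilde_mul (D : nat -> 'cV[R]_w) :
  Rtilde L Rm *m (mxvec (\matrix_(p < L.+1, q < w) D p q 0))^T = mxact Rm D.
Proof. by rewrite blockrow_mul (@mxact_trunc _ _ _ L.+1). Qed.

Lemma XtildeL_mul (D : nat -> 'cV[R]_w) :
  XtildeL L X *m (mxvec (\matrix_(p < L.+1, q < w) D p q 0))^T = mxact X D.
Proof.
rewrite blockrow_mul (@mxact_trunc _ _ _ L) // big_ord_recr /= ltnn mul0mx addr0.
by apply: eq_bigr => i _; rewrite /= ltn_ord.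
Qed.

Lemma XtildeR_mul (D : nat -> 'cV[R]_w) :
  XtildeR L X *m (mxvec (\matrix_(p < L.+1, q < w) D p q 0))^T
  = mxact X (fun i => D i.+1).
Proof.
rewrite blockrow_mul (@mxact_trunc _ _ _ L) // big_ord_recl /= mul0mx add0r.
exact: eq_bigr.
Qed.

End Tilde.
End PolynomialAction.

Arguments mxact {R w m} P D.

(** * Evaluation at complex points and invertibility of the modal matrix *)

Section ModalMatrix.
Variables (R : realType) (w : nat).
Local Notation C := R[i].

(** Bundled as a ring morphism so that [mxevalC] inherits compatibility with matrix sums and
    products. *)
Definition evalC (z : C) : {rmorphism {poly R} -> C} :=
  horner_eval z \o map_poly (real_complex R).

Lemma evalCX z : evalC z 'X = z.
Proof. by rewrite /= map_polyX /horner_eval hornerX. Qed.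

Lemma evalCC z (a : R) : evalC z a%:P = (a%:C)%C.
Proof. by rewrite /= map_polyC /horner_eval hornerC. Qed.

Lemma mxevalCE m n (P : 'M[{poly R}]_(m, n)) z : mxevalC P z = map_mx (evalC z) P.
Proof. by []. Qed.

Lemma mxevalC_const m n (A : 'M[R]_(m, n)) z :
  mxevalC (map_mx polyC A) z = realC A.
Proof. by apply/matrixP => i j; rewrite mxevalCE !mxE evalCC. Qed.

Lemma state_map_evalC n m (Rm : 'M[{poly R}]_w) (X : 'M[{poly R}]_(n, w))
    (H : 'M[{poly R}]_(m, w)) (A : 'M[R]_(m, n)) (P : 'M[{poly R}]_(m, w))
    (z : C) (v : 'cV[C]_w) :
  H = map_mx polyC A *m X + P *m Rm -> mxevalC Rm z *m v = 0 ->
  mxevalC H z *m v = realC A *m (mxevalC X z *m v).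
Proof.
move=> -> Rv.
rewrite mxevalCE map_mxD !map_mxM -!mxevalCE mxevalC_const mulmxDl -!mulmxA.
by rewrite Rv mulmx0 addr0.
Qed.

(** Applying [M - z] to a relation between eigenvectors multiplies the [i]-th coefficient by
    [lam i - z]. Taking for [s] all other eigenvalues isolates one eigenspace. *)
Lemma eigenvectors_weighted_sum_eq0 (F : fieldType) n p (M : 'M[F]_n)
    (v : 'I_p -> 'cV[F]_n) (lam a : 'I_p -> F) (s : seq F) :
  (forall i, M *m v i = lam i *: v i) -> \sum_i a i *: v i = 0 ->
  \sum_i (a i * \prod_(z <- s) (lam i - z)) *: v i = 0.
Proof.
move=> Mv av; elim: s => [|z s IH].
  by rewrite -[RHS]av; apply: eq_bigr => i _; rewrite big_nil mulr1.
have := congr1 (fun u => M *m u - z *: u) IH.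
rewrite mulmx0 scaler0 subr0 mulmx_sumr scaler_sumr -sumrB => e.
rewrite -[RHS]e; apply: eq_bigr => i _.
rewrite big_cons -scalemxAr Mv !scalerA -scalerBl; congr (_ *: _); ring.
Qed.

(* The columns are eigenvectors of the state matrix, and those belonging to
   one eigenvalue are independent because [w_i] is a linear image of
   [X(lambda_i) w_i]. *)
Lemma Vmat_unit n (Rm : 'M[{poly R}]_w) (X : 'M[{poly R}]_(n, w))
    (lam : 'I_n -> C) (wv : 'I_n -> 'cV[C]_w) :
  \det Rm != 0 -> minimal_state_map Rm X ->
  (forall i, mxevalC Rm (lam i) *m wv i = 0) ->
  (forall i (c : 'I_n -> C), (forall j, lam j != lam i -> c j = 0) ->
     \sum_j c j *: wv j = 0 -> forall j, c j = 0) ->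
  Vmat X lam wv \in unitmx.
Proof.
move=> dR mX Rw indw.
have [A [PA eA]] := @state_map_rep _ _ _ _ _ _ ('X *: X) dR mX.
have [B [PB eB]] := @state_map_rep _ _ _ _ _ _ (1%:M) dR mX.
pose v i := mxevalC X (lam i) *m wv i.
have Av i : realC A *m v i = lam i *: v i.
  rewrite -(@state_map_evalC _ _ _ _ _ _ _ _ _ eA (Rw i)).
  by rewrite mxevalCE map_mxZ evalCX -scalemxAl.
have Bv i : realC B *m v i = wv i.
  rewrite -(@state_map_evalC _ _ _ _ _ _ _ _ _ eB (Rw i)).
  by rewrite mxevalCE map_mx1 mul1mx.
rewrite -unitmx_tr -row_free_unit; apply: inj_row_free => c cV.
have av : \sum_i c 0 i *: v i = 0.
  rewrite -[RHS]trmx0 -cV trmx_mul trmxK; apply/colP => r.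
  rewrite summxE mxE; apply: eq_bigr => i _.
  by rewrite [X in X * _]mxE [c^T _ _]mxE mxE mulrC.
apply/rowP => i; rewrite [RHS]mxE.
(* The weights vanish exactly at indices whose eigenvalue differs from [lam i]. Mapping the
   remaining relation by [B] gives one between the [wv j] of a single eigenvalue. *)
pose s := [seq lam j | j <- enum 'I_n & lam j != lam i].
pose b j := c 0 j * \prod_(z <- s) (lam j - z).
have b0 j : b j = 0.
  apply: (indw i) => [{}j ji|].
    rewrite /b (big_rem (lam j)) /=; first by rewrite subrr mul0r mulr0.
    by apply: map_f; rewrite mem_filter ji mem_enum.
  have := @eigenvectors_weighted_sum_eq0 _ _ _ _ _ _ (fun j => c 0 j) s Av av.
  move/(congr1 (mulmx (realC B))); rewrite mulmx0 mulmx_sumr => e.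
  by rewrite -[RHS]e; apply: eq_bigr => k _; rewrite -scalemxAr Bv.
have /eqP := b0 i; rewrite mulf_eq0 => /orP[/eqP //|].
rewrite prodf_seq_eq0 => /hasP[z /mapP[j]].
rewrite mem_filter => /andP[ji _] -> /=.
by rewrite subr_eq0 eq_sym (negbTE ji).
Qed.

(** Testing the Hermitian inequality on [V^-1 x] removes the congruence by [V] and leaves real
    numbers. *)
Lemma herm_psd_congr_real n (V : 'M[C]_n) (K M : 'M[R]_n) (x : 'cV[R]_n) :
  V \in unitmx ->
  herm_psd (ctrmx V *m realC K *m V - ctrmx V *m realC M *m V) ->
  bilin M x x <= bilin K x x.
Proof.
move=> uV [_ /(_ (invmx V *m realC x))].
have ctrmxM p q r (S : 'M[C]_(p, q)) (T : 'M[C]_(q, r)) :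
    ctrmx (S *m T) = ctrmx T *m ctrmx S.
  by rewrite /ctrmx map_mxM trmx_mul.
have rx : ctrmx (realC x) = realC x^T.
  by apply/matrixP => i j; rewrite !mxE conjc_real.
have e (S : 'M[R]_n) : ctrmx (invmx V *m realC x) *m (ctrmx V *m realC S *m V)
    *m (invmx V *m realC x) = realC (x^T *m S *m x).
  rewrite !mulmxA -ctrmxM mulKVmx // -!mulmxA mulKVmx // rx.
  by rewrite /realC !map_mxM !mulmxA.
rewrite mulmxBr mulmxBl !e mxE [X in _ + X]mxE [realC _ _ _]mxE.
by rewrite [realC _ _ _]mxE -rmorphB ler0c subr_ge0.
Qed.

End ModalMatrix.

(** * Induction on real intervals, monotonicity, entrywise derivatives and limits *)

Section RealAnalysis.
Local Open Scope classical_set_scope.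
Variable R : realType.
Implicit Types (t u : R) (h : R -> R).

(** The supremum of the points reachable from [a] is itself reachable, by the left half of the local
    hypothesis, and by the right half it cannot lie before [b]. Later [P] expresses constancy or
    decay of a quantity between two times. *)
Lemma real_interval_induction (P : R -> R -> Prop) :
  (forall a, P a a) ->
  (forall a b c, a <= b -> b <= c -> P a b -> P b c -> P a c) ->
  (forall t, exists2 e : R, 0 < e &
     (forall u, t - e < u < t -> P u t) /\ (forall u, t < u < t + e -> P t u)) ->
  forall a b, a <= b -> P a b.
Proof.
move=> Pr Pt Pl a b ab.
pose S := [set x | a <= x <= b /\ P a x].
have Sa : S a by split; rewrite ?lexx ?ab.
have hS : has_sup S by split; [exists a | exists b => x [/andP[]]].
have am : a <= sup S by apply: sup_upper_bound.
have mb : sup S <= b by apply: ge_sup; [exists a | move=> x [/andP[]]].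
have [e e0 [Pleft Pright]] := Pl (sup S).
have [x [/andP[ax xb] Pax] xm] := sup_adherent e0 hS.
have xm' : x <= sup S by apply: sup_upper_bound => //; split; rewrite ?ax.
have Pam : P a (sup S).
  have [<-//|xNm] := eqVneq x (sup S).
  by apply: (Pt _ x) => //; apply: Pleft; rewrite xm lt_neqAle xNm.
have [<-//|mNb] := eqVneq (sup S) b.
have mltb : sup S < b by rewrite lt_neqAle mNb.
(* A point beyond the supremum, still at most [b] and inside the right neighbourhood: reaching it is
   the contradiction. *)
pose u := Num.min b (sup S + e / 2).
have e20 : 0 < e / 2 by rewrite divr_gt0.
have mu : sup S < u by rewrite lt_min mltb ltrDl e20.
have ue : u < sup S + e.
  rewrite (le_lt_trans (_ : _ <= sup S + e / 2)) ?ge_min ?lexx ?orbT //.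
  by rewrite ltrD2l ltr_pdivrMr // ltr_pMr // ltr1n.
have ub : u <= b by rewrite ge_min lexx.
have : u <= sup S.
  apply: sup_upper_bound => //; split; first by rewrite ub (le_trans am) // ltW.
  by apply: (Pt _ _ _ am (ltW mu) Pam); apply: Pright; rewrite mu.
by rewrite leNgt mu.
Qed.

Lemma is_derive_nonincreasing h (dh : R -> R) :
  (forall t, is_derive t 1 h (dh t)) -> (forall t, dh t <= 0) ->
  forall a b, a <= b -> h b <= h a.
Proof.
move=> Dh dh0 a b ab.
have ch : {within `[a, b], continuous h}.
  by apply: derivable_within_continuous => x _; have [] := Dh x.
have [c _ e] := MVT_segment ab (fun x _ => Dh x) ch.
by rewrite -subr_le0 e mulr_le0_ge0 // subr_ge0.
Qed.

Lemma nonincreasing_cvg0_ge0 h :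
  (forall a b, a <= b -> h b <= h a) -> h t @[t --> +oo] --> 0 ->
  forall a, 0 <= h a.
Proof.
move=> hd h0 a; apply: (cvgr_to_le h0).
near=> t; apply: hd; near: t; apply: nbhs_pinfty_ge; exact: num_real.
Unshelve. all: end_near. Qed.

Lemma is_derive_sum_fct n (h : 'I_n -> R -> R) (dh : 'I_n -> R) t :
  (forall i, is_derive t 1 (h i) (dh i)) ->
  is_derive t 1 (fun u => \sum_i h i u) (\sum_i dh i).
Proof. by move=> Dh; rewrite -fct_sumE; exact: is_derive_sum. Qed.

Lemma is_derive_mul h g (dh dg : R) t :
  is_derive t 1 h dh -> is_derive t 1 g dg ->
  is_derive t 1 (fun u => h u * g u) (h t * dg + g t * dh).
Proof. by move=> Dh Dg; exact: is_deriveM. Qed.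

Lemma is_derive_scale h (c dh : R) t :
  is_derive t 1 h dh -> is_derive t 1 (fun u => c * h u) (c * dh).
Proof.
by move=> Dh; apply: is_derive_eq (is_derive_mul _ _ _ _ _ (is_derive_cst c t 1) Dh) _;
  rewrite mulr0 addr0.
Qed.

Lemma is_derive_expR_scale (c : R) t :
  is_derive t 1 (fun u => expR (c * u)) (c * expR (c * t)).
Proof.
have D : is_derive t 1 (fun u => c * u) c.
  by apply: is_derive_eq (is_derive_scale _ c _ _ (is_derive_id t 1)) _; rewrite mulr1.
apply: is_derive_eq (is_derive1_comp (is_derive_expR (c * t)) D) _.
by rewrite mulrC.
Qed.

Lemma is_derive_mx m (x : R -> 'cV[R]_m) t : derivable x t 1 ->
  forall a, is_derive t 1 (fun u => x u a 0) ((x^`() t) a 0).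
Proof.
move=> dx a; split; first by have /derivable_mxP := dx; apply.
by rewrite derive1E derive_mx // mxE.
Qed.

Lemma is_derive_mulmx m n (A : 'M[R]_(m, n)) (x : R -> 'cV[R]_n) (dx : 'cV[R]_n) t :
  (forall a, is_derive t 1 (fun u => x u a 0) (dx a 0)) ->
  forall a, is_derive t 1 (fun u => (A *m x u) a 0) ((A *m dx) a 0).
Proof.
move=> Dx a; rewrite mxE.
under eq_fun do rewrite mxE.
by apply: is_derive_sum_fct => b; apply: is_derive_scale.
Qed.

Lemma is_derive_bilin n (A : 'M[R]_n) (x : R -> 'cV[R]_n) (dx : 'cV[R]_n) t :
  (forall a, is_derive t 1 (fun u => x u a 0) (dx a 0)) ->
  is_derive t 1 (fun u => bilin A (x u) (x u)) (bilin A dx (x t) + bilin A (x t) dx).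
Proof.
move=> Dx; under eq_fun do rewrite bilinE.
rewrite !bilinE -big_split /=; apply: is_derive_sum_fct => i.
rewrite -big_split /=; apply: is_derive_sum_fct => j.
apply: is_derive_eq (is_derive_scale _ _ _ _ (is_derive_mul _ _ _ _ _ (Dx i) (Dx j))) _.
ring.
Qed.

Lemma cvg0_sum_fct n (h : 'I_n -> R -> R) :
  (forall i, h i t @[t --> +oo] --> 0) -> \sum_i h i t @[t --> +oo] --> 0.
Proof.
elim: n h => [|n IH] h h0.
  by under eq_fun do rewrite big_ord0; exact: cvg_cst.
under eq_fun do rewrite big_ord_recl.
have := IH (fun i => h (lift ord0 i)) (fun i => h0 _).
by move=> /(cvgD (h0 ord0)); rewrite addr0.
Qed.

Lemma cvg0_scale h (c : R) : h t @[t --> +oo] --> 0 -> c * h t @[t --> +oo] --> 0.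
Proof. by move=> h0; rewrite -(mulr0 c); apply: cvgM => //; exact: cvg_cst. Qed.

Lemma cvg0_mulmx m n (A : 'M[R]_(m, n)) (x : R -> 'cV[R]_n) :
  (forall a, x t a 0 @[t --> +oo] --> 0) ->
  forall a, (A *m x t) a 0 @[t --> +oo] --> 0.
Proof.
move=> x0 a; under eq_fun do rewrite mxE.
by apply: cvg0_sum_fct => b; apply: cvg0_scale.
Qed.

Lemma cvg0_bilin n (A : 'M[R]_n) (x : R -> 'cV[R]_n) :
  (forall a, x t a 0 @[t --> +oo] --> 0) ->
  bilin A (x t) (x t) @[t --> +oo] --> 0.
Proof.
move=> x0; under eq_fun do rewrite bilinE.
apply: cvg0_sum_fct => i; apply: cvg0_sum_fct => j; apply: cvg0_scale.
by rewrite -(mulr0 0); apply: cvgM.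
Qed.

Lemma converges_to_0P m (x : R -> 'cV[R]_m) :
  converges_to_0 x <-> forall a, x t a 0 @[t --> +oo] --> 0.
Proof.
split=> [x0 a|x0].
  have -> : (0 : R) = (0 : 'cV[R]_m) a 0 by rewrite mxE.
  apply: (@cvg_comp _ _ _ x (fun M : 'cV[R]_m => M a 0) _ _ _ x0).
  exact: coord_continuous.
apply/cvgr0Pnorm_lt => e e0.
have : \forall t \near +oo, forall a, `|x t a 0| < e.
  by apply: filter_forall => a; apply: (cvgr0_norm_lt _ (x0 a)).
apply: filterS => t xt.
rewrite /Num.norm /= mx_normrE; apply: bigmax_lt => // -[i j] _ /=.
by rewrite ord1.
Qed.

End RealAnalysis.

(** * Trajectories of one mode: state equation, derivative, coercivity and decay of the form *)

Section Trajectories.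
Local Open Scope classical_set_scope.
Variables (R : realType) (w : nat).
Implicit Types (f : R -> 'cV[R]_w) (t : R).

Definition jet (f : R -> 'cV[R]_w) (t : R) (i : nat) : 'cV[R]_w := derive1n i f t.

Lemma diffopE m (P : 'M[{poly R}]_(m, w)) f t : diffop P f t = mxact P (jet f t).
Proof. by []. Qed.

Lemma smooth_jet f : smooth f -> forall i t a,
  is_derive t 1 (fun u => jet f u i a 0) (jet f t i.+1 a 0).
Proof. by move=> sf i t a; rewrite /jet derive1nS; exact: is_derive_mx. Qed.

Lemma is_derive_mxact m (P : 'M[{poly R}]_(m, w)) (D : R -> nat -> 'cV[R]_w) :
  (forall i t a, is_derive t 1 (fun u => D u i a 0) (D t i.+1 a 0)) ->
  forall t a, is_derive t 1 (fun u => mxact P (D u) a 0)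
                            (mxact P (fun i => D t i.+1) a 0).
Proof.
move=> DD t a; rewrite summxE; under eq_fun do rewrite summxE.
by apply: is_derive_sum_fct => i; apply: is_derive_mulmx.
Qed.

Lemma derive1n_add i j (f : R -> 'cV[R]_w) :
  derive1n i (derive1n j f) = derive1n (i + j) f.
Proof. by elim: i => // i IH; rewrite addSn !derive1nS IH. Qed.

Section Mode.
Variable Rm : 'M[{poly R}]_w.

(** Differentiating the action along a jet shifts the jet by one, and the derivative of the zero
    function is zero; hence the equation persists at each order. *)
Lemma behaviour_jet f : behaviour Rm f ->
  forall j t, mxact Rm (fun i => jet f t (i + j)%N) = 0.
Proof.
case=> sf Rf; elim=> [|j IH] t.
  by rewrite -[RHS](Rf t) diffopE; congr mxact; apply/funext => i; rewrite addn0.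
apply/colP => a; rewrite [RHS]mxE.
have D := @is_derive_mxact _ Rm (fun t i => jet f t (i + j)%N)
  (fun i t a => smooth_jet _ sf _ t a) t a.
have -> : (fun i => jet f t (i + j.+1)%N) = (fun i => jet f t (i.+1 + j)%N).
  by apply/funext => i; rewrite addSnnS.
rewrite -(@derive_val _ _ _ _ _ _ _ D) -[RHS](derive_cst (0 : R) t 1); congr ('D_1 _ t).
by apply/funext => u; rewrite IH mxE.
Qed.

Lemma behaviour_derive1n f j : behaviour Rm f -> behaviour Rm (derive1n j f).
Proof.
move=> Bf; split=> [k t|t]; first by rewrite derive1n_add; case: Bf => + _; apply.
rewrite -[RHS](behaviour_jet _ Bf j t) diffopE; congr mxact.
by apply/funext => i; rewrite /jet derive1n_add.
Qed.

(** Each derivative of [f] is again a trajectory of the mode, so stability applies to it as well. *)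
Lemma stable_diffop_cvg0 f m (P : 'M[{poly R}]_(m, w)) :
  behaviour_asympt_stable Rm -> behaviour Rm f ->
  forall a, diffop P f t a 0 @[t --> +oo] --> 0.
Proof.
move=> st Bf a; under eq_fun do rewrite diffopE summxE.
apply: cvg0_sum_fct => i; apply: cvg0_mulmx.
have /converges_to_0P di := st _ (behaviour_derive1n _ i Bf).
by move=> b; exact: di.
Qed.

Lemma behaviour_diffop f m (P : 'M[{poly R}]_(m, w)) t :
  behaviour Rm f -> diffop (P *m Rm) f t = 0.
Proof. by move=> Bf; rewrite diffopE mxact_mul_eq0 => // j; exact: behaviour_jet. Qed.

Variables (n : nat) (X : 'M[{poly R}]_(n, w)).

Lemma diffop_rep f m (H : 'M[{poly R}]_(m, w)) (A : 'M[R]_(m, n)) P t :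
  H = map_mx polyC A *m X + P *m Rm -> behaviour Rm f ->
  diffop H f t = A *m diffop X f t.
Proof.
move=> -> Bf; rewrite diffopE mxactD mxact_const_mul.
by rewrite -(diffopE _ (P *m Rm)) behaviour_diffop // addr0.
Qed.

Lemma diffop1 f t : diffop 1%:M f t = f t.
Proof.
rewrite diffopE (@mxact_trunc _ _ _ _ _ 1) => [|[//|i] _].
  rewrite big_ord1 (_ : coefmx _ _ = 1%:M) ?mul1mx //.
  by apply/matrixP => a b; rewrite !mxE coefMn coef1.
by apply/matrixP => a b; rewrite !mxE coefMn coef1 mul0rn.
Qed.

Lemma qdf_XKXE (K : 'M[R]_n) f t :
  qdf_XKX X K f t = bilin K (diffop X f t) (diffop X f t).
Proof.
rewrite /qdf_XKX /qdf /bilin /diffop.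
rewrite (raddf_sum (@trmx R n 1)) /= !mulmx_suml summxE; apply: eq_bigr => h _.
rewrite mulmx_sumr summxE; apply: eq_bigr => j _.
by rewrite /XKX_coef trmx_mul !mulmxA.
Qed.

Lemma qdf_XKX_fctE (K : 'M[R]_n) f :
  qdf_XKX X K f = fun t => bilin K (diffop X f t) (diffop X f t).
Proof. by apply/funext => t; rewrite qdf_XKXE. Qed.

Variables (L : nat) (K F : 'M[R]_n) (Y : 'M[R]_(w, n)).
Hypothesis degR : forall i, (L < i)%N -> coefmx Rm i = 0.
Hypothesis degX : forall i, (L <= i)%N -> coefmx X i = 0.

Lemma bilin_Phitilde x : bilin (Phitilde L Rm X K Y) x x =
  bilin K (XtildeR L X *m x) (XtildeL L X *m x)
  + bilin K (XtildeL L X *m x) (XtildeR L X *m x)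
  - bilin Y^T (XtildeL L X *m x) (Rtilde L Rm *m x)
  - bilin Y (Rtilde L Rm *m x) (XtildeL L X *m x).
Proof. by rewrite /Phitilde !(bilinDm, bilinNm) !bilin_congr. Qed.

Lemma Phitilde_factor : real_nsd (Phitilde L Rm X K Y) ->
  Phitilde L Rm X K Y = (XtildeL L X)^T
    *m ((pinvmx (XtildeL L X))^T *m Phitilde L Rm X K Y *m pinvmx (XtildeL L X))
    *m XtildeL L X.
Proof.
move=> nPhi; apply: real_nsd_factor => // x x0.
by rewrite bilin_Phitilde x0 !(bilin0l, bilin0r) addr0 !subr0.
Qed.

Hypothesis eF : Phitilde L Rm X K Y = (XtildeL L X)^T *m F *m XtildeL L X.

Lemma is_derive_state f t : behaviour Rm f -> forall a,
  is_derive t 1 (fun u => diffop X f u a 0) (diffop ('X *: X) f t a 0).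
Proof.
case=> sf _ a; rewrite diffopE mxact_mulX.
by apply: is_derive_mxact => *; exact: smooth_jet.
Qed.

(** On the stacked jet of [f], [XtildeL] gives the state, [XtildeR] its derivative and [Rtilde]
    gives zero. So the terms in [Y] drop out and [Phitilde] is the derivative of [x^T K x]. *)
Lemma qdf_XKX_derive f t : behaviour Rm f ->
  is_derive t 1 (qdf_XKX X K f) (bilin F (diffop X f t) (diffop X f t)).
Proof.
move=> Bf; have [sf Rf] := Bf.
rewrite qdf_XKX_fctE; apply: is_derive_eq (is_derive_bilin _ _ K _ _ _ (is_derive_state f t Bf)) _.
have := bilin_Phitilde (mxvec (\matrix_(p < L.+1, q < w) jet f t p q 0))^T.
rewrite eF bilin_congr XtildeL_mul // XtildeR_mul // Rtilde_mul // -!diffopE Rf.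
by rewrite bilin0l bilin0r !subr0 !diffopE mxact_mulX => ->.
Qed.

Hypothesis dR : \det Rm != 0.
Hypothesis mX : minimal_state_map Rm X.
Hypothesis stR : behaviour_asympt_stable Rm.
Hypothesis nF : real_nd F.

Lemma output_of_state : exists C : 'M[R]_(w, n),
  forall f t, behaviour Rm f -> f t = C *m diffop X f t.
Proof.
have [C [P eC]] := @state_map_rep _ _ _ _ _ _ (1%:M) dR mX.
by exists C => f t Bf; rewrite -(diffop_rep _ _ _ _ _ t eC Bf) diffop1.
Qed.

(* [Q - c |f|^2] decreases along trajectories for small [c > 0] and tends
   to [0], hence is nonnegative. *)
Lemma qdf_XKX_coercive : exists2 c : R, 0 < c & forall f t, behaviour Rm f ->
  c * \sum_b f t b 0 ^+ 2 <= qdf_XKX X K f t.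
Proof.
have [C fC] := output_of_state.
have [A [P eA]] := @state_map_rep _ _ _ _ _ _ ('X *: X) dR mX.
(* Thus [|f|^2 = x^T B x], with derivative given by [A^T B + B A]. The choice [c = 1 / (M + 1)]
   makes [c M <= 1], so that [F] absorbs this derivative. *)
pose B := C^T *m C.
have [M M0 HM] := @real_nd_dominates _ _ F (A^T *m B + B *m A) nF.
have c0 : 0 < (M + 1)^-1 by rewrite invr_gt0; lra.
exists (M + 1)^-1 => // f t Bf; set c := (M + 1)^-1.
have -> : \sum_b f t b 0 ^+ 2 = bilin B (diffop X f t) (diffop X f t).
  rewrite /B bilin_mulr -[C^T]mulmx1 bilin_mull -fC // /bilin mulmx1 mxE.
  by apply: eq_bigr => b _; rewrite mxE expr2.
rewrite -subr_ge0.
pose h u := qdf_XKX X K f u - c * bilin B (diffop X f u) (diffop X f u).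
apply: (@nonincreasing_cvg0_ge0 _ h _ _ t) => {t}; last first.
  have x0 := stable_diffop_cvg0 _ _ X stR Bf.
  rewrite -(subr0 0) /h; apply: cvgB; last exact/cvg0_scale/cvg0_bilin.
  by rewrite qdf_XKX_fctE; exact: cvg0_bilin.
apply: (@is_derive_nonincreasing _ h (fun t =>
    bilin F (diffop X f t) (diffop X f t)
    - c * bilin (A^T *m B + B *m A) (diffop X f t) (diffop X f t))) => t.
  apply: is_deriveB; first exact: qdf_XKX_derive.
  apply: is_derive_scale.
  apply: is_derive_eq (is_derive_bilin _ _ B _ _ _ (is_derive_state f t Bf)) _.
  by rewrite (diffop_rep _ _ _ _ _ t eA Bf) bilinDm (@bilin_mull _ _ _ _ A B) (@bilin_mulr _ _ _ _ B A).
have := HM (diffop X f t); rewrite ler_norml => /andP[lo _].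
set q := bilin F _ _ in lo *; set r := bilin (_ + _) _ _ in lo *.
have q0 : 0 <= - q by rewrite oppr_ge0; exact: real_nd_le0.
have : c * - r <= c * (M * - q) by rewrite ler_pM2l //; lra.
have cM : c * M <= 1 by rewrite /c mulrC ler_pdivrMr; lra.
have : c * M * - q <= 1 * - q by rewrite ler_wpM2r.
by lra.
Qed.

(** Since [- F] dominates [K], the derivative [exp (be t) (x^T F x + be Q)] is nonpositive for small
    [be]. All rates below [al] are allowed so that the modes can share one. *)
Lemma qdf_XKX_decay : exists2 al : R, 0 < al & forall be, 0 <= be <= al ->
  forall f, behaviour Rm f -> forall a b, a <= b ->
  expR (be * b) * qdf_XKX X K f b <= expR (be * a) * qdf_XKX X K f a.
Proof.
have [M M0 HM] := @real_nd_dominates _ _ F K nF.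
have c0 : 0 < (M + 1)^-1 by rewrite invr_gt0; lra.
exists (M + 1)^-1 => // be /andP[be0 beM] f Bf.
apply: (@is_derive_nonincreasing _ (fun t => expR (be * t) * qdf_XKX X K f t)
  (fun t => expR (be * t) * bilin F (diffop X f t) (diffop X f t)
            + qdf_XKX X K f t * (be * expR (be * t)))) => t.
  by apply: is_derive_mul; [exact: is_derive_expR_scale|exact: qdf_XKX_derive].
have -> : forall e q Q : R, e * q + Q * (be * e) = e * (q + be * Q) by move=> *; ring.
rewrite pmulr_rle0 ?expR_gt0 // qdf_XKXE.
have := HM (diffop X f t); rewrite ler_norml => /andP[_ hi].
set q := bilin F _ _ in hi *; set r := bilin K _ _ in hi *.
have q0 : 0 <= - q by rewrite oppr_ge0; exact: real_nd_le0.
have : be * r <= be * (M * - q) by rewrite ler_wpM2l.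
have bM : be * M <= 1.
  by apply: le_trans (ler_wpM2r M0 beM) _; rewrite mulrC ler_pdivrMr; lra.
have : be * M * - q <= 1 * - q by rewrite ler_wpM2r.
by lra.
Qed.

End Mode.
End Trajectories.

(** * Locality of derivatives and of quadratic differential forms *)

Section Locality.
Variables (R : realType) (w : nat).
Implicit Types (f g : R -> 'cV[R]_w).

Lemma derive1n_local f g (a b : R) : (forall u, a < u < b -> f u = g u) ->
  forall i t, a < t < b -> derive1n i f t = derive1n i g t.
Proof.
move=> fg; elim=> [|i IH] t tab; first exact: fg.
rewrite !derive1nS !derive1E; apply: near_eq_derive.
have : t \in `]a, b[ by rewrite in_itv.
move=> /near_in_itvoo; apply: filterS => u.
by rewrite in_itv /=; exact: IH.
Qed.

Lemma qdf_local d (Psi : nat -> nat -> 'M[R]_w) f g (a b t : R) :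
  a < t < b -> (forall u, a < u < b -> f u = g u) ->
  qdf d Psi f t = qdf d Psi g t.
Proof.
move=> tab fg; apply: eq_bigr => h _; apply: eq_bigr => j _.
by rewrite !(@derive1n_local _ _ _ _ fg _ t tab).
Qed.

End Locality.

(** * Switching instants and intervals of constancy *)

Section Switching.
Variables (R : realType) (N : nat) (s : R -> 'I_N).

Lemma const_no_switch (a b : R) j : (forall u, a < u < b -> s u = j) ->
  forall x, a < x < b -> ~ switch_instant s x.
Proof.
move=> sj x xab [e [e0 He]].
have [u /andP[]] : exists u, Num.max a (x - e) < u < x.
  have : Num.max a (x - e) < x.
    by rewrite gt_max; apply/andP; split; [case/andP: xab | lra].
  by move=> lt; exists ((Num.max a (x - e) + x) / 2); lra.
rewrite gt_max => /andP[au xeu] ux.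
have := He u; rewrite xeu ux => /(_ isT).
by rewrite !sj ?eqxx //; lra.
Qed.

Lemma no_switch_const : switching_signal s -> forall a b, a <= b ->
  (forall x, a < x <= b -> ~ switch_instant s x) -> s a = s b.
Proof.
move=> [rc ll _].
apply: (@real_interval_induction _ (fun a b : R =>
  (forall x, a < x <= b -> ~ switch_instant s x) -> s a = s b)) => //.
- move=> a b c ab bc Pab Pbc ns; rewrite Pab => [|x xab]; last by apply: ns; lra.
  by rewrite Pbc // => x xbc; apply: ns; lra.
- move=> t; have [e1 e10 He1] := rc t; have [e2 e20 [j He2]] := ll t.
  exists (Num.min e1 e2); first by rewrite lt_min e10.
  have [m1 m2] : Num.min e1 e2 <= e1 /\ Num.min e1 e2 <= e2.
    by split; rewrite ge_min lexx ?orbT.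
  split=> u ut ns; last by rewrite He1 //; lra.
  rewrite (He2 u); last lra.
  (* If the value [j] just before [t] differed from [s t], then [t] would be a switching instant. *)
  apply: contrapT => jt; apply: (ns t); first by lra.
  by exists e2; split=> // v vt; rewrite He2 //; apply/eqP.
Qed.

Lemma switch_neq (t u : R) : switching_signal s -> switch_instant s t -> u < t ->
  (forall x, u < x < t -> ~ switch_instant s x) -> s u != s t.
Proof.
move=> ss [e [e0 He]] ut ns.
have [y /andP[]] : exists y, Num.max u (t - e) < y < t.
  have : Num.max u (t - e) < t by rewrite gt_max ut /=; lra.
  by move=> lt; exists ((Num.max u (t - e) + t) / 2); lra.
rewrite gt_max => /andP[uy tey] yt.
rewrite (@no_switch_const ss u y (ltW uy)) => [|x xuy]; last by apply: ns; lra.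
by apply: He; rewrite tey.
Qed.

Lemma no_switch_same_piece (a b t u : R) :
  (forall x, a < x < b -> ~ switch_instant s x) ->
  a <= t < b -> a <= u < b -> same_piece s t u.
Proof.
move=> ns tab uab x /andP[]; rewrite gt_min le_max => H1 H2; apply: ns.
by case/orP: H1; case/orP: H2; lra.
Qed.

End Switching.

(** * Decay across switches and stability, for an abstract family of local functionals [Q] *)

Section SwitchedDecay.
Local Open Scope classical_set_scope.
Variables (R : realType) (w N : nat).
Variables (Rm : 'I_N -> 'M[{poly R}]_w) (g : 'I_N -> 'I_N -> nat).
Variables (Gm Gp : forall k l : 'I_N, 'M[{poly R}]_(g k l, w)).
Variables (Q : 'I_N -> (R -> 'cV[R]_w) -> R -> R) (al c : R).
Hypothesis localQ : forall k f h (a b t : R), a < t < b ->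
  (forall u, a < u < b -> f u = h u) -> Q k f t = Q k h t.
Hypothesis decayQ : forall k f, behaviour (Rm k) f -> forall a b, a <= b ->
  expR (al * b) * Q k f b <= expR (al * a) * Q k f a.
Hypothesis jumpQ : forall s traj f, switched_solution Rm Gm Gp s traj f ->
  forall t u, switch_instant s t -> u < t ->
  (forall x, u < x < t -> ~ switch_instant s x) ->
  Q (s t) (traj t) t <= Q (s u) (traj u) t.

(** By interval induction it suffices to compare each [t] with nearby times on either side, where at
    most one switch, at [t], occurs. *)
Lemma switched_decay s traj f : switched_solution Rm Gm Gp s traj f ->
  forall a b, a <= b ->
  expR (al * b) * Q (s b) (traj b) b <= expR (al * a) * Q (s a) (traj a) a.
Proof.
move=> sol; have [[rc ll _] Btraj ftraj _] := sol.
apply: (@real_interval_induction _ (fun a b : R =>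
  expR (al * b) * Q (s b) (traj b) b <= expR (al * a) * Q (s a) (traj a) a)) => //.
  by move=> a b d _ _ ba db; exact: le_trans db ba.
move=> t; have [e1 e10 He1] := rc t; have [e2 e20 [j He2]] := ll t.
exists (Num.min e1 e2); first by rewrite lt_min e10.
have [m1 m2] : Num.min e1 e2 <= e1 /\ Num.min e1 e2 <= e2.
  by split; rewrite ge_min lexx ?orbT.
have ns1 : forall x, t < x < t + e1 -> ~ switch_instant s x.
  by apply: const_no_switch => u ut; apply: He1; lra.
have ns2 : forall x, t - e2 < x < t -> ~ switch_instant s x.
  exact: const_no_switch He2.
split=> u ut.
(* If [s] jumps at [t], the mode [s u] decays up to [t] and the jump condition follows. Otherwise
   [traj u] and [traj t] agree on an open interval around [t], so [Q] takes the same value on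
   both. *)
- have [jt|jt] := eqVneq j (s t); last first.
    have sw : switch_instant s t.
      by exists e2; split=> // v vt; rewrite He2.
    have le1 : Q (s t) (traj t) t <= Q (s u) (traj u) t.
      by apply: (jumpQ _ _ _ sol) => // [|x xut]; [lra | apply: ns2; lra].
    apply: le_trans (decayQ _ _ (Btraj u) u t _); last lra.
    by rewrite ler_pM2l // expR_gt0.
  have ns : forall x, t - e2 < x < t + e1 -> ~ switch_instant s x.
    apply: (@const_no_switch _ _ _ _ _ (s t)) => v vt.
    by have [vlt|tv] := ltP v t; [rewrite He2 //; lra | rewrite He1 //; lra].
  have su : s u = s t by rewrite He2 //; lra.
  have -> : Q (s t) (traj t) t = Q (s u) (traj u) t.
    rewrite su; apply: (@localQ _ _ _ (t - e2) (t + e1)); first by lra.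
    move=> y yt; rewrite -!ftraj //.
      by apply: no_switch_same_piece ns _ _; lra.
    by apply: no_switch_same_piece ns _ _; lra.
  by apply: decayQ => //; lra.
(* To the right, the trajectories are compared at the interior point [u], as [t] may be a switching
   instant. *)
- have su : s u = s t by rewrite He1 //; lra.
  have -> : Q (s u) (traj u) u = Q (s t) (traj t) u.
    rewrite su; apply: (@localQ _ _ _ t (t + e1)); first by lra.
    move=> y yt; rewrite -!ftraj //.
      by apply: no_switch_same_piece ns1 _ _; lra.
    by apply: no_switch_same_piece ns1 _ _; lra.
  by apply: decayQ => //; lra.
Qed.

Hypothesis al_gt0 : 0 < al.
Hypothesis c_gt0 : 0 < c.
Hypothesis coerciveQ : forall k f t, behaviour (Rm k) f ->
  c * \sum_b f t b 0 ^+ 2 <= Q k f t.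

Lemma switched_stable : slds_asympt_stable Rm Gm Gp.
Proof.
move=> f [s [traj sol]]; have [_ Btraj ftraj _] := sol.
apply/converges_to_0P => b; apply/cvgr0Pnorm_lt => e e0.
pose W0 := Q (s 0) (traj 0) 0.
(* The linear bound [1 + al t <= exp (al t)] suffices for convergence and gives an explicit
   threshold for [t]. *)
have bound t : 0 <= t -> c * f t b 0 ^+ 2 * (1 + al * t) <= W0.
  move=> t0.
  have ft : f t = traj t t.
    by apply: ftraj => x; rewrite minxx maxxx => /andP[tx xt]; lra.
  have := switched_decay _ _ _ sol _ _ t0.
  rewrite mulr0 expR0 mul1r -/W0; apply: le_trans.
  rewrite mulrC; apply: ler_pM.
  - by have := mulr_ge0 (ltW al_gt0) t0; lra.
  - by rewrite mulr_ge0 ?sqr_ge0 // ltW.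
  - exact: expR_ge1Dx.
  apply: le_trans (coerciveQ _ _ _ (Btraj t)); rewrite ler_pM2l // ft.
  rewrite (bigD1 b) //= lerDl; apply: sumr_ge0 => *; exact: sqr_ge0.
near=> t.
have t0 : 0 <= t by near: t; apply: nbhs_pinfty_ge; exact: num_real.
(* Past this time, [|f_b| >= e] would give [c e^2 (1 + al t) <= W0 <= c e^2 al t]. *)
have tW : W0 / (c * e ^+ 2 * al) <= t.
  by near: t; apply: nbhs_pinfty_ge; exact: num_real.
have e20 : 0 < e ^+ 2 by rewrite exprn_gt0.
rewrite -(@ltr_pXn2r _ 2) ?nnegrE ?(ltW e0) //.
rewrite real_normK ?num_real // ltNge; apply/negP => le.
move: tW; rewrite ler_pdivrMr ?mulr_gt0 // => tW.
have := bound t t0.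
have ce : c * e ^+ 2 <= c * f t b 0 ^+ 2 by rewrite ler_pM2l.
have ce0 : 0 < c * e ^+ 2 by rewrite mulr_gt0.
have at0 : 0 <= al * t by rewrite mulr_ge0 // ltW.
have : c * e ^+ 2 * (1 + al * t) <= c * f t b 0 ^+ 2 * (1 + al * t).
  by rewrite ler_wpM2r //; lra.
by move=> l1 l2; nra.
Unshelve. all: end_near. Qed.

End SwitchedDecay.

(** * Constants common to all modes, and the assembly of the result *)

Lemma fin_lower_bound (R : realType) (N : nat) (P : 'I_N -> R -> Prop) :
  (forall k, exists2 c : R, 0 < c & forall d, 0 < d <= c -> P k d) ->
  exists2 c : R, 0 < c & forall k, P k c.
Proof.
move=> HP.
have /choice[c Hc] : forall k, exists c : R, 0 < c /\ forall d, 0 < d <= c -> P k d.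
  by move=> k; have [c c0 Hc] := HP k; exists c.
(* The initial value [1] keeps the minimum positive even over an empty family. *)
exists (\big[Num.min/1]_k c k) => [|k].
  by apply: lt_bigmin => // k _; have [] := Hc k.
have [_] := Hc k; apply; apply/andP; split; last exact: bigmin_le_cond.
by apply: lt_bigmin => // l _; have [] := Hc l.
Qed.

Theorem theorem3 (R : realType) (w N : nat)
  (Rm : 'I_N -> 'M[{poly R}]_w)
  (n : 'I_N -> nat) (X : forall k : 'I_N, 'M[{poly R}]_(n k, w))
  (L : 'I_N -> nat)
  (lam : forall k : 'I_N, 'I_(n k) -> R[i])
  (wv : forall k : 'I_N, 'I_(n k) -> 'cV[R[i]]_w)
  (g : 'I_N -> 'I_N -> nat)
  (Gm Gp : forall k l : 'I_N, 'M[{poly R}]_(g k l, w))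
  (Fm : forall k l : 'I_N, 'M[R]_(g k l, n k))
  (Fp : forall k l : 'I_N, 'M[R]_(g k l, n l))
  (Fpinv : forall k l : 'I_N, 'M[R]_(n l, g k l))
  (* modes: R_k nonsingular, B_k asymptotically stable, n_k = deg det R_k *)
  (HRns : forall k, \det (Rm k) != 0)
  (HBstab : forall k, behaviour_asympt_stable (Rm k))
  (Hn : forall k, size (\det (Rm k)) = (n k).+1)
  (* X_k minimal state map *)
  (HX : forall k, minimal_state_map (Rm k) (X k))
  (* R_k = sum_{i=0}^{L_k} R_{k,i} xi^i,  X_k = sum_{i=0}^{L_k - 1} X_{k,i} xi^i *)
  (HRdeg : forall k (i : nat), (L k < i)%N -> coefmx (Rm k) i = 0)
  (HXdeg : forall k (i : nat), (L k <= i)%N -> coefmx (X k) i = 0)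
  (* lam k i, i < n k: the roots of det R_k counted with multiplicity *)
  (Hroots : forall k,
     map_poly (fun x : R => (x%:C)%C) (\det (Rm k))
     = ((lead_coef (\det (Rm k)))%:C)%C%:P * \prod_(i < n k) ('X - (lam k i)%:P))
  (* algebraic multiplicity = dim ker R_k(lam) *)
  (Hmult : forall k i,
     #|[set j | lam k j == lam k i]| = (w - \rank (mxevalC (Rm k) (lam k i)))%N)
  (Hwv : forall k i, mxevalC (Rm k) (lam k i) *m wv k i = 0)
  (Hwind : forall k i (c : 'I_(n k) -> R[i]),
     (forall j, lam k j != lam k i -> c j = 0) ->
     \sum_j c j *: wv k j = 0 -> forall j, c j = 0)
  (* re-initialisation maps: G^-_{k->l} mod R_k = F^- X_k, G^+_{k->l} mod R_l = F^+ X_l,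
     Fpinv a (fixed) left inverse of F^+; L_{k->l} = Fpinv * F^- *)
  (HFm : forall k l, k != l ->
     is_polymod (Rm k) (Gm k l) (map_mx polyC (Fm k l) *m X k))
  (HFp : forall k l, k != l ->
     is_polymod (Rm l) (Gp k l) (map_mx polyC (Fp k l) *m X l))
  (HFpinv : forall k l, k != l -> Fpinv k l *m Fp k l = 1%:M) :
  forall (K : forall k : 'I_N, 'M[R]_(n k)) (Y : forall k : 'I_N, 'M[R]_(w, n k)),
  (forall k, real_nsd (Phitilde (L k) (Rm k) (X k) (K k) (Y k))) ->
  (exists F : forall k : 'I_N, 'M[R]_(n k), forall k,
     Phitilde (L k) (Rm k) (X k) (K k) (Y k)
     = (XtildeL (L k) (X k))^T *m F k *m XtildeL (L k) (X k)) /\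
  (forall F : forall k : 'I_N, 'M[R]_(n k),
     (forall k, Phitilde (L k) (Rm k) (X k) (K k) (Y k)
                = (XtildeL (L k) (X k))^T *m F k *m XtildeL (L k) (X k)) ->
     (forall k, real_nd (F k)) ->
     (forall k l, k != l ->
        herm_psd (ctrmx (Vmat (X k) (lam k) (wv k)) *m realC (K k)
                    *m Vmat (X k) (lam k) (wv k)
                  - ctrmx (Vmat (X k) (lam k) (wv k))
                    *m realC ((Fpinv k l *m Fm k l)^T *m K l *m (Fpinv k l *m Fm k l))
                    *m Vmat (X k) (lam k) (wv k))) ->
     slds_asympt_stable Rm Gm Gp /\
     multiple_lyapunov Rm Gm Gp (fun k => qdf_XKX (X k) (K k))).
Proof.
move=> K Y nPhi; split.
  by eexists => k; exact: Phitilde_factor (nPhi k).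
move=> F eF nF psd.
have derQ k f (t : R) : behaviour (Rm k) f ->
    is_derive t 1 (qdf_XKX (X k) (K k) f)
      (bilin (F k) (diffop (X k) f t) (diffop (X k) f t)).
  exact: qdf_XKX_derive (HRdeg k) (HXdeg k) (eF k) _ _.
have [c c0 coerQ] : exists2 c : R, 0 < c & forall k f t, behaviour (Rm k) f ->
    c * \sum_b f t b 0 ^+ 2 <= qdf_XKX (X k) (K k) f t.
  apply: fin_lower_bound => k.
  have [c c0 Hc] := qdf_XKX_coercive _ _ _ _ _ _ _ _ _ (HRdeg k) (HXdeg k)
    (eF k) (HRns k) (HX k) (HBstab k) (nF k).
  exists c => // d /andP[d0 dc] f t Bf; apply: le_trans (Hc f t Bf).
  by rewrite ler_wpM2r // sumr_ge0 // => b _; exact: sqr_ge0.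
have [al al0 decQ] : exists2 al : R, 0 < al & forall k f, behaviour (Rm k) f ->
    forall a b, a <= b -> expR (al * b) * qdf_XKX (X k) (K k) f b
                          <= expR (al * a) * qdf_XKX (X k) (K k) f a.
  apply: fin_lower_bound => k.
  have [al al0 Hal] := qdf_XKX_decay _ _ _ _ _ _ _ _ _ (HRdeg k) (HXdeg k)
    (eF k) (nF k).
  by exists al => // be /andP[be0 beal]; apply: Hal; rewrite ltW.
have jumpQ s traj f : switched_solution Rm Gm Gp s traj f ->
    forall t u, switch_instant s t -> u < t ->
    (forall x, u < x < t -> ~ switch_instant s x) ->
    qdf_XKX (X (s t)) (K (s t)) (traj t) t
    <= qdf_XKX (X (s u)) (K (s u)) (traj u) t.
  move=> sol t u sw ut ns; have [ss Btraj _ glue] := sol.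
  have ne : s u != s t := @switch_neq _ _ _ _ _ ss sw ut ns.
  have := glue t u sw ut ns.
  have [Pp [eP _]] := HFp _ _ ne; have [Pm [eM _]] := HFm _ _ ne.
  rewrite (@diffop_rep _ _ _ _ (X (s t)) _ _ _ (Fp _ _) Pp t _ (Btraj t)); last first.
    by rewrite eP subrK.
  rewrite (@diffop_rep _ _ _ _ (X (s u)) _ _ _ (Fm _ _) Pm t _ (Btraj u)); last first.
    by rewrite eM subrK.
  (* In terms of states the gluing condition reads [F+ x(t+) = F- x(t-)]; the left inverse turns it
     into [x(t+) = L x(t-)]. *)
  move=> /(congr1 (mulmx (Fpinv (s u) (s t)))).
  rewrite !mulmxA HFpinv // mul1mx => eL.
  rewrite !qdf_XKXE eL -bilin_congr.
  apply: herm_psd_congr_real (psd _ _ ne).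
  exact: Vmat_unit (HRns _) (HX _) (Hwv _) (Hwind _).
have posQ k f t : behaviour (Rm k) f -> 0 <= qdf_XKX (X k) (K k) f t.
  move=> Bf; apply: le_trans (coerQ k f t Bf).
  by rewrite mulr_ge0 ?(ltW c0) // sumr_ge0 // => b _; exact: sqr_ge0.
split.
  apply: (@switched_stable _ _ _ _ _ _ _ (fun k => qdf_XKX (X k) (K k)) al c) => //.
  by move=> k f h a b t tab fh; exact: qdf_local tab fh.
split=> // [k f Bf t|k f Bf]; first exact: posQ.
have dQ t : derive1 (qdf_XKX (X k) (K k) f) t
    = bilin (F k) (diffop (X k) f t) (diffop (X k) f t).
  by rewrite derive1E; apply: derive_val; exact: derQ.
split=> [t|Q0]; first by rewrite dQ; exact: real_nd_le0.
have [C fC] := output_of_state _ _ _ _ _ (HRns k) (HX k).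
apply/funext => t; rewrite (fC f t Bf).
(* A zero derivative of [Q] forces the state to vanish by definiteness of [F k], and [f] is a linear
   image of the state. *)
have [->|xNz] := eqVneq (diffop (X k) f t) 0; first by rewrite mulmx0.
have [_ nFk] := nF k; have := nFk _ xNz.
by rewrite -/(bilin _ _ _) -dQ Q0 ltxx.
Qed.
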